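(* Let $P>1$ be an odd integer and let \[ N(P)=\sum_{D=1}^{P-1}\ \sum_{\epsilon,\eta\in\{1,-1\}} \tau\big((P-\delta_P)\,|\epsilon P+\eta D|\big),\] where $\tau$ is the number-of-positive-divisors function. Then $N(P)=O\big(\tau(P-\delta_P)\,P\log P\big)$.
   Context: Fix an integer $d$; for an odd positive integer $m$, $\delta_m$ denotes the Jacobi symbol $\left(\frac{d}{m}\right)$. The quantity $N(P)$ counts the candidate pairs $(D,\Delta)$ generated by the ''$D\Delta$ method'': for each $1\le D\le P-1$ and each of the four choices of signs $(\delta_q,\delta_r)\in\{\pm1\}^2$, $\Delta$ runs over the divisors of $(P-\delta_P)(\delta_qP+\delta_rD)$. The implied constant in $O(\cdot)$ is absolute. *)

(* Defs.v *)
From mathcomp Require Import all_boot all_order all_algebra.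

Set Implicit Arguments.
Unset Strict Implicit.
Unset Printing Implicit Defensive.

Import GRing.Theory Num.Theory.

Local Open Scope ring_scope.

Definition legendre (d : int) (p : nat) : int :=
  if (p%:Z %| d)%Z then 0
  else if [exists x : 'I_p, (x%:Z ^+ 2 == d %[mod p%:Z])%Z] then 1
  else -1.

(* The Jacobi symbol (d / m), meaningful for m odd: the product of the Legendre
   symbols over the prime factors of m counted with multiplicity; it is 0 when
   d and m are not coprime. *)
Definition jacobi (d : int) (m : nat) : int :=
  \prod_(p <- primes m) legendre d p ^+ logn p m.

(* [divisors 0] is empty, so [tau 0 = 0]; below, for P > 1, tau is only applied
   to positive arguments. *)
Definition tau (n : nat) : nat := size (divisors n).

(* P - (d / P), as a natural number; the absolute value changes nothing for
   P > 0, since (d / P) <= 1. *)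
Definition Pdelta (d : int) (P : nat) : nat := `|P%:Z - jacobi d P|%N.

Definition NDDelta (d : int) (P : nat) : nat :=
  (\sum_(1 <= D < P)
     \sum_(e <- [:: 1; -1]%R) \sum_(h <- [:: 1; -1]%R)
       tau (Pdelta d P * `|(e * P%:Z + h * D%:Z)%R|))%N.

(* Main.v *)
(** Since tau is submultiplicative, the factor [tau (P - delta_P)] comes out of
    the sum. The remaining arguments [|+-P +- D|] take the values [P + D] and
    [P - D] twice each, so they run twice through distinct integers below [2P],
    and counting multiples gives
    [\sum_(k <= n) tau k = \sum_(a <= n) floor (n / a) <= n (1 + ln n)]. *)
Require Import Defs.
From mathcomp Require Import all_boot all_order all_algebra.
From mathcomp Require Import all_classical all_reals all_analysis.
From mathcomp Require Import zify ring lra.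

Set Implicit Arguments.
Unset Strict Implicit.
Unset Printing Implicit Defensive.

Import Order.TTheory GRing.Theory Num.Theory.

Local Open Scope ring_scope.

(* [divisors 0] evaluates to [[:: 1]], so [tau 0 = 1]. *)
Lemma tau_gt0 (n : nat) : (0 < tau n)%N.
Proof.
case: n => // n; rewrite /tau; have := dvdn_divisors 1 (ltn0Sn n).
by rewrite dvd1n; case: divisors.
Qed.

(** A divisor [x] of [m * n] splits as [gcdn x m] times its cofactor, which divides [n]; so every
    such [x] occurs among the products of a divisor of [m] and a divisor of [n]. *)
Lemma tauM_leq (m n : nat) : (tau (m * n) <= tau m * tau n)%N.
Proof.
have [->|m_gt0] := posnP m; first by rewrite mul0n leq_pmulr ?tau_gt0.
have [->|n_gt0] := posnP n; first by rewrite muln0 leq_pmull ?tau_gt0.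
rewrite /tau -(size_allpairs muln); apply: uniq_leq_size => [|x].
  exact: divisors_uniq.
rewrite -dvdn_divisors ?muln_gt0 ?m_gt0 // => x_dvd.
have x_gt0 : (0 < x)%N by apply: dvdn_gt0 x_dvd; rewrite muln_gt0 m_gt0.
apply/allpairsP; exists (gcdn x m, x %/ gcdn x m)%N => /=; split.
- by rewrite -dvdn_divisors // dvdn_gcdr.
- rewrite -dvdn_divisors // dvdn_divLR ?gcdn_gt0 ?x_gt0 ?dvdn_gcdl //.
  (* The cofactor divides [n] because [x] divides both [n * x] and [n * m], hence their gcd
     [n * gcdn x m]. *)
  by rewrite muln_gcdr dvdn_gcd dvdn_mull //= mulnC.
- by rewrite mulnC divnK // dvdn_gcdl.
Qed.

(** The range of [a] is independent of [k], which lets the double sum over [k] and [a] be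
    exchanged. *)
Lemma tau_sum_dvdn (n k : nat) : (0 < k <= n)%N ->
  tau k = (\sum_(1 <= a < n.+1) (a %| k))%N.
Proof.
move=> /andP[k_gt0 le_kn].
have eqD : perm_eq (divisors k) [seq a <- index_iota 1 n.+1 | (a %| k)%N].
  apply: uniq_perm => [||a]; first exact: divisors_uniq.
    by rewrite filter_uniq ?iota_uniq.
  rewrite -dvdn_divisors // mem_filter mem_index_iota.
  case: (boolP (a %| k)%N) => //= a_dvd.
  by rewrite (dvdn_gt0 k_gt0 a_dvd) ltnS (leq_trans (dvdn_leq k_gt0 a_dvd)).
by rewrite /tau (perm_size eqD) size_filter -sum1_count big_mkcond.
Qed.

Lemma sum_tau (n : nat) :
  (\sum_(1 <= k < n.+1) tau k = \sum_(1 <= a < n.+1) n %/ a)%N.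
Proof.
rewrite big_nat (eq_bigr _ (fun k => @tau_sum_dvdn n k)) -big_nat exchange_big.
by apply: eq_bigr => a _; rewrite divn_count_dvd.
Qed.

Lemma sum_harmonic_le (R : realType) (n : nat) :
  \sum_(1 <= a < n.+2) (a%:R : R)^-1 <= 1 + ln (n.+1%:R : R).
Proof.
elim: n => [|n IHn]; first by rewrite big_nat1 invr1 ln1 addr0.
rewrite big_nat_recr //=.
have y_gt0 : 0 < (n.+2%:R : R) by rewrite ltr0n.
have x_gt0 : 0 < (n.+1%:R : R) by rewrite ltr0n.
have yV : n.+1%:R / n.+2%:R = 1 - (n.+2%:R : R)^-1.
  by rewrite -[in LHS](addrK 1 n.+1%:R) natr1 mulrBl divff ?gt_eqF // mul1r.
(* Taking [x = -1/(n+2)] in [ln (1 + x) <= x] gives [1/(n+2) <= ln (n+2) - ln (n+1)], the increment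
   needed. *)
have := @le_ln1Dx R (- (n.+2%:R)^-1).
rewrite -yV ln_div ?posrE // ltrN2 invf_lt1 // ltr1n => /(_ isT).
rewrite lerBlDl lerBrDr => ln_step.
apply: (le_trans (lerD IHn (lexx _))).
by rewrite -addrA lerD2l.
Qed.

Lemma sum_tau_le (R : realType) (n : nat) : (0 < n)%N ->
  (\sum_(1 <= k < n.+1) tau k)%:R <= n%:R * (1 + ln (n%:R : R)).
Proof.
case: n => // n _; rewrite sum_tau natr_sum.
apply: (@le_trans _ _ (\sum_(1 <= a < n.+2) n.+1%:R * (a%:R : R)^-1)).
  apply: ler_sum_nat => a /andP[a_gt0 _].
  by rewrite ler_pdivlMr ?ltr0n // -natrM ler_nat leq_trunc_div.
by rewrite -mulr_sumr ler_wpM2l // sum_harmonic_le.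
Qed.

(** [P - D] sweeps the integers from [1] to [P - 1], and [P + D] those from [P + 1] to [2P - 1]; the
    terms [k = P] and [k = 2P] on the right are dropped. *)
Lemma sum_tau_symmetric_leq (P : nat) : (0 < P)%N ->
  (\sum_(1 <= D < P) (tau (P + D) + tau (P - D))
     <= \sum_(1 <= k < P.*2.+1) tau k)%N.
Proof.
move=> P_gt0; rewrite big_split /= addnC.
rewrite [leqRHS](@big_cat_nat _ _ _ P) //=; last by lia.
rewrite [X in (X + _)%N]big_nat_rev /=; apply: leq_add.
  rewrite !big_nat; apply: leq_sum => D /andP[D_gt0 ltDP].
  by rewrite add1n subSS subKn // ltnW.
rewrite [leqRHS](@big_cat_nat _ _ _ (1 + P)) //=; last by lia.
rewrite big_addn.
have -> : (P.*2.+1 - P = P.+1)%N by lia.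
rewrite [X in (_ <= _ + X)%N]big_nat_recr //=.
rewrite (eq_bigr (fun D => tau (D + P))) => [|D _]; last by rewrite addnC.
by rewrite addnCA leq_addr.
Qed.

Lemma NDDelta_leq (d : int) (P : nat) : (0 < P)%N ->
  (NDDelta d P <= tau (Pdelta d P) * (2 * \sum_(1 <= k < P.*2.+1) tau k))%N.
Proof.
move=> P_gt0.
apply: (@leq_trans (tau (Pdelta d P) *
    (2 * \sum_(1 <= D < P) (tau (P + D) + tau (P - D))))).
  rewrite mulnA big_distrr /= /NDDelta !big_nat.
  apply: leq_sum => D /andP[D_gt0 ltDP].
  rewrite !big_cons !big_nil.
  (* As [D < P], the truncated difference [P - D] is the true absolute value. *)
  have -> : `|(1 * P%:Z + 1 * D%:Z)%R|%N = (P + D)%N by lia.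
  have -> : `|(1 * P%:Z + -1 * D%:Z)%R|%N = (P - D)%N by lia.
  have -> : `|(-1 * P%:Z + 1 * D%:Z)%R|%N = (P - D)%N by lia.
  have -> : `|(-1 * P%:Z + -1 * D%:Z)%R|%N = (P + D)%N by lia.
  have := tauM_leq (Pdelta d P) (P + D); have := tauM_leq (Pdelta d P) (P - D).
  nia.
by rewrite !leq_mul2l sum_tau_symmetric_leq ?orbT.
Qed.

Theorem theorem6 (R : realType) :
  exists C : R, 0 < C /\
    forall (d : int) (P : nat), odd P -> (1 < P)%N ->
      (NDDelta d P)%:R <= C * ((tau (Pdelta d P))%:R * P%:R * ln (P%:R : R)).
Proof.
(* Since [1 <= 2 ln 2 <= 2 ln P], one has [2P (1 + ln 2 + ln P) <= 8 P ln P]; the two runs through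
   the integers double this to 16. *)
exists 16; split => // d P _ P_gt1.
have P_gt0 : (0 < P)%N by apply: ltnW.
have P_gt0R : 0 < (P%:R : R) by rewrite ltr0n.
have P_ge2 : 2 <= (P%:R : R) by rewrite ler_nat.
have ln2_ge : 1 / 2 <= ln (2 : R).
  (* At [x = -1/2], [ln (1 + x) <= x] reads [- ln 2 <= -1/2]. *)
  have := @le_ln1Dx R (- (1 / 2)).
  have -> : 1 + - (1 / 2) = (2 : R)^-1 by lra.
  rewrite lnV ?posrE // ltrN2 => /(_ _); lra.
have ln2_le : ln (2 : R) <= ln (P%:R : R) by rewrite ler_ln ?posrE.
have ln2P : ln (P.*2%:R : R) = ln 2 + ln P%:R.
  by rewrite -mul2n natrM lnM ?posrE.
have sum_le : (\sum_(1 <= k < P.*2.+1) tau k)%:R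
    <= 8 * (P%:R * ln (P%:R : R)).
  apply: (le_trans (@sum_tau_le R P.*2 _)); first by rewrite double_gt0.
  rewrite ln2P -mul2n natrM; nra.
apply: (@le_trans _ _ ((tau (Pdelta d P))%:R *
    (2 * (\sum_(1 <= k < P.*2.+1) tau k)%:R))).
  by rewrite -!natrM ler_nat NDDelta_leq.
rewrite [leRHS](_ : _ = (tau (Pdelta d P))%:R *
    (2 * (8 * (P%:R * ln (P%:R : R))))); last by ring.
by rewrite !ler_wpM2l.
Qed.
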